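(* Let $V$ be a vertex algebra over $\mathbb{C}$ and let $a(z)$ be a pseudoderivation of $V$ such that $[a(z),a(x)]=0$ and such that for every $v\in V$ there exists a positive integer $k$ with $a(z)^kv=0$. Then $\exp a(z)$ is a pseudoautomorphism of $V$.
   Context: Vertex algebras are over $\mathbb{C}$, with vacuum vector $\mathbf{1}$ and vertex operator map $Y\colon V\to \mathrm{Hom}(V,V((x)))$, $Y(v,x)=\sum_{n\in\mathbb{Z}}v_n x^{-n-1}$. The canonical operator $\mathcal{D}$ on $V$ is $\mathcal{D}(v)=v_{-2}\mathbf{1}$; it acts on $\mathbb{C}((z))\otimes V$ as $1\otimes\mathcal{D}$. Conventions: $\otimes=\otimes_{\mathbb{C}}$ (the algebraic tensor product), and $z,x$ are independent formal variables. For $f(z)\in\mathbb{C}((z))$, $f(z+x)=e^{x\,d/dz}f(z)\in\mathbb{C}((z))[[x]]$. For a $\mathbb{C}$-linear map $B(z)\colon V\to\mathbb{C}((z))\otimes V$ with $B(z)v=\sum_i f_i(z)\otimes v_i$ (a finite sum), $B(z+x)v=\sum_i f_i(z+x)\otimes v_i\in\mathbb{C}((z))[[x]]\otimes V$, and $\frac{d}{dz}B(z)$ is the map $v\mapsto(\frac{d}{dz}\otimes 1)(B(z)v)$. The map $Y(\cdot,x)$ is extended $\mathbb{C}((z))[[x]]$-linearly to $\mathbb{C}((z))[[x]]\otimes V$, and the operators $Y(u,x)$ are extended $\mathbb{C}((z))$-linearly to act on $\mathbb{C}((z))\otimes V$. Maps $V\to\mathbb{C}((z))\otimes V$ are composed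 by extending them $\mathbb{C}((z))$-linearly to endomorphisms of $\mathbb{C}((z))\otimes V$; this gives meaning to $a(z)^k$ and to $\exp a(z)=\sum_{k\ge 0}a(z)^k/k!$. The condition $[a(z),a(x)]=0$ means that $a(z)a(x)=a(x)a(z)$ as maps from $V$ to $\mathbb{C}((z))\otimes\mathbb{C}((x))\otimes V$, each of $a(z),a(x)$ being extended linearly over the other factor. A pseudoderivation of $V$ is a $\mathbb{C}$-linear map $a(z)\colon V\to\mathbb{C}((z))\otimes V$ such that $$[\mathcal{D},a(z)]=-\frac{d}{dz}a(z),\qquad [a(z),Y(u,x)]=Y(a(z+x)u,x)\quad\text{for } u\in V.$$ A pseudoendomorphism of $V$ is a $\mathbb{C}$-linear map $A(z)\colon V\to\mathbb{C}((z))\otimes V$ such that $$A(z)\mathbf{1}=\mathbf{1}\ (=1\otimes\mathbf{1}),\qquad [\mathcal{D},A(z)]=-\frac{d}{dz}A(z),\qquad A(z)Y(v,x)=Y(A(z+x)v,x)A(z)\ \text{ for } v\in V.$$ All of these are identities of maps on $V$, with $a(z)$, $A(z)$ applied coefficientwise in $x$. A pseudoautomorphism of $V$ is an invertible pseudoendomorphism, i.e. a pseudoendomorphism $A(z)$ for which there is a $\mathbb{C}$-linear map $B(z)\colon V\to\mathbb{C}((z))\otimes V$ with $A(z)B(z)=B(z)A(z)=1$. *)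

(* Defs.v *)
From HB Require Import structures.
From mathcomp Require Import all_boot all_order all_algebra.
From mathcomp Require Import generic_quotient finmap.
From mathcomp Require Import boolp classical_sets functions cardinality fsbigop.
From mathcomp Require Import reals.
From mathcomp.real_closed Require Import complex.

Set Implicit Arguments.
Unset Strict Implicit.
Unset Printing Implicit Defensive.

Import Order.TTheory GRing.Theory Num.Theory.

Local Open Scope quotient_scope.
Local Open Scope classical_set_scope.
Local Open Scope ring_scope.

Definition bilinear_map (K : fieldType) (U V W : lmodType K)
    (b : U -> V -> W) : Prop :=
  (forall v, linear (b^~ v)) /\ (forall u, linear (b u)).

Lemma linear_fun0 (K : fieldType) (U V : lmodType K) (f : U -> V) :
  linear f -> f 0 = 0.
Proof. by move=> lf; have := lf (-1) 0 0; rewrite scaler0 addr0 scaleN1r addNr. Qed.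

Lemma linear_funD (K : fieldType) (U V : lmodType K) (f : U -> V) :
  linear f -> {morph f : x y / x + y}.
Proof. by move=> lf x y; have := lf 1 x y; rewrite !scale1r. Qed.

Lemma linear_funZ (K : fieldType) (U V : lmodType K) (f : U -> V) :
  linear f -> forall c, {morph f : x / c *: x}.
Proof. by move=> lf c x; have := lf c x 0; rewrite (linear_fun0 lf) !addr0. Qed.

Lemma linear_sum (K : fieldType) (U V : lmodType K) (f : U -> V) :
  linear f ->
  forall (I : Type) (r : seq I) (F : I -> U),
    f (\sum_(i <- r) F i) = \sum_(i <- r) f (F i).
Proof.
move=> lf I r F; elim: r => [|i r IH]; first by rewrite !big_nil linear_fun0.
by rewrite !big_cons linear_funD // IH.
Qed.

(* The tensor product over a field: formal finite sums of pairs (u, v), two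
   sums being identified when every bilinear map takes the same value on
   them. [tliftE], [tlift_linear] and [tlift_unique] below are the universal
   property. *)
Section TensorProduct.
Variables (K : fieldType) (U V : lmodType K).

Definition teval (W : lmodType K) (b : U -> V -> W) (s : seq (U * V)) : W :=
  \sum_(p <- s) b p.1 p.2.

Definition tensor_rel (s t : seq (U * V)) : bool :=
  `[< forall (W : lmodType K) (b : U -> V -> W),
        bilinear_map b -> teval b s = teval b t >].

Lemma tensor_rel_refl : reflexive tensor_rel.
Proof. by move=> s; apply/asboolP. Qed.

Lemma tensor_rel_sym : symmetric tensor_rel.
Proof.
by move=> s t; apply/asboolP/asboolP => h W b bb; rewrite (h W b bb).
Qed.

Lemma tensor_rel_trans : transitive tensor_rel.
Proof.
move=> t s u /asboolP h1 /asboolP h2; apply/asboolP => W b bb.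
by rewrite (h1 W b bb) (h2 W b bb).
Qed.

Canonical tensor_equiv :=
  EquivRel tensor_rel tensor_rel_refl tensor_rel_sym tensor_rel_trans.

Definition tensor : Type := {eq_quot tensor_equiv}.
HB.instance Definition _ := Choice.on tensor.
HB.instance Definition _ := EqQuotient.on tensor.

Definition mktensor (s : seq (U * V)) : tensor := \pi_tensor s.

Definition tens (u : U) (v : V) : tensor := mktensor [:: (u, v)].

(* The linear map induced by b, meaningful when b is bilinear. *)
Definition tlift (W : lmodType K) (b : U -> V -> W) (x : tensor) : W :=
  teval b (repr x).

Lemma tlift_mk (W : lmodType K) (b : U -> V -> W) s :
  bilinear_map b -> tlift b (mktensor s) = teval b s.
Proof.
move=> bb; rewrite /tlift /mktensor; case: piP => t /eqmodP /asboolP h.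
by rewrite (h W b bb).
Qed.

Lemma tensor_ext (x y : tensor) :
  (forall (W : lmodType K) (b : U -> V -> W),
     bilinear_map b -> tlift b x = tlift b y) -> x = y.
Proof.
move=> h; rewrite -[x]reprK -[y]reprK; apply/eqmodP/asboolP => W b bb.
exact: h.
Qed.

Definition tensor_zero : tensor := mktensor [::].
Definition tensor_add (x y : tensor) : tensor := mktensor (repr x ++ repr y).
Definition tensor_scale (c : K) (x : tensor) : tensor :=
  mktensor [seq (c *: p.1, p.2) | p <- repr x].
Definition tensor_opp (x : tensor) : tensor := tensor_scale (-1) x.

Section LiftOps.
Variables (W : lmodType K) (b : U -> V -> W) (bb : bilinear_map b).

Let lift0 : tlift b tensor_zero = 0.
Proof. by rewrite tlift_mk // /teval big_nil. Qed.

Let liftD x y : tlift b (tensor_add x y) = tlift b x + tlift b y.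
Proof. by rewrite tlift_mk // /teval big_cat. Qed.

Let liftZ c x : tlift b (tensor_scale c x) = c *: tlift b x.
Proof.
rewrite tlift_mk // /teval big_map scaler_sumr; apply: eq_bigr => p _ /=.
exact: (linear_funZ (bb.1 p.2)).
Qed.

Let liftN x : tlift b (tensor_opp x) = - tlift b x.
Proof. by rewrite liftZ scaleN1r. Qed.

Definition tlift_ops := (lift0, liftD, liftN, liftZ).
End LiftOps.

Lemma tensor_addA : associative tensor_add.
Proof. by move=> x y z; apply: tensor_ext => W b bb; rewrite !tlift_ops ?addrA. Qed.
Lemma tensor_addC : commutative tensor_add.
Proof. by move=> x y; apply: tensor_ext => W b bb; rewrite !tlift_ops // addrC. Qed.
Lemma tensor_add0 : left_id tensor_zero tensor_add.
Proof. by move=> x; apply: tensor_ext => W b bb; rewrite !tlift_ops // add0r. Qed.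
Lemma tensor_addN : left_inverse tensor_zero tensor_opp tensor_add.
Proof. by move=> x; apply: tensor_ext => W b bb; rewrite !tlift_ops // addNr. Qed.

HB.instance Definition _ := GRing.isZmodule.Build tensor
  tensor_addA tensor_addC tensor_add0 tensor_addN.

Lemma tensor_scaleA c d x :
  tensor_scale c (tensor_scale d x) = tensor_scale (c * d) x.
Proof. by apply: tensor_ext => W b bb; rewrite !tlift_ops // scalerA. Qed.
Lemma tensor_scale1 : left_id 1 tensor_scale.
Proof. by move=> x; apply: tensor_ext => W b bb; rewrite !tlift_ops // scale1r. Qed.
Lemma tensor_scaleDr : right_distributive tensor_scale +%R.
Proof.
move=> c x y; apply: tensor_ext => W b bb.
by rewrite !(tlift_ops bb) scalerDr.
Qed.
Lemma tensor_scaleDl x : {morph tensor_scale^~ x : c d / c + d}.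
Proof.
move=> c d; apply: tensor_ext => W b bb.
by rewrite !(tlift_ops bb) scalerDl.
Qed.

HB.instance Definition _ := GRing.Zmodule_isLmodule.Build K tensor
  tensor_scaleA tensor_scale1 tensor_scaleDr tensor_scaleDl.

Section Universal.
Variables (W : lmodType K) (b : U -> V -> W) (bb : bilinear_map b).

Lemma tlift_linear : linear (tlift b).
Proof. by move=> c x y; rewrite (tlift_ops bb) (tlift_ops bb). Qed.

Lemma tliftE u v : tlift b (tens u v) = b u v.
Proof. by rewrite tlift_mk // /teval big_seq1. Qed.
End Universal.

Lemma tens_bilinear : bilinear_map tens.
Proof.
split=> [v|u] c x y; apply: tensor_ext => W b bb;
  rewrite (tlift_linear bb) !tliftE //.
- exact: (bb.1 v).
- exact: (bb.2 u).
Qed.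

Lemma tensor_sumE (x : tensor) : exists s, x = \sum_(p <- s) tens p.1 p.2.
Proof.
exists (repr x); apply: tensor_ext => W b bb.
rewrite (linear_sum (tlift_linear bb)) {1}/tlift /teval.
by apply: eq_bigr => p _; rewrite tliftE.
Qed.

Lemma tlift_unique (W : lmodType K) (f g : tensor -> W) :
  linear f -> linear g ->
  (forall u v, f (tens u v) = g (tens u v)) -> f =1 g.
Proof.
move=> lf lg h x; have [s ->] := tensor_sumE x.
by rewrite !linear_sum //; apply: eq_bigr.
Qed.

End TensorProduct.

Definition tmap (K : fieldType) (U V U' V' : lmodType K)
    (f : U -> U') (g : V -> V') : tensor U V -> tensor U' V' :=
  tlift (fun u v => tens (f u) (g v)).

Lemma tmap_bilinear (K : fieldType) (U V U' V' : lmodType K)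
    (f : U -> U') (g : V -> V') :
  linear f -> linear g -> bilinear_map (fun u v => tens (f u) (g v)).
Proof.
move=> lf lg; split=> [v|u] c x y.
- by rewrite lf (tens_bilinear _ _).1.
- by rewrite lg (tens_bilinear _ _).2.
Qed.

(* M((x)): sum_n f_n x^n with f_n = 0 for all n below some bound. *)
Definition laurent_pred (K : fieldType) (M : lmodType K) : pred (int -> M) :=
  fun f => `[< exists N : int, forall n : int, (n < N)%R -> f n = 0 >].

Lemma laurent_submod (K : fieldType) (M : lmodType K) :
  submod_closed (@laurent_pred K M).
Proof.
split=> [|c f g /asboolP [N hN] /asboolP [P hP]].
  by apply/asboolP; exists 0.
apply/asboolP; exists (Num.min N P) => n; rewrite lt_min => /andP [nN nP].
by rewrite -[LHS]/(c *: f n + g n) hN // hP // scaler0 addr0.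
Qed.

HB.instance Definition _ (K : fieldType) (M : lmodType K) :=
  GRing.isSubmodClosed.Build K (int -> M) (@laurent_pred K M)
    (@laurent_submod K M).

Record laurent (K : fieldType) (M : lmodType K) := Laurent {
  coef :> int -> M;
  coefP : coef \in @laurent_pred K M }.
HB.instance Definition _ (K : fieldType) (M : lmodType K) :=
  [isSub for @coef K M].
HB.instance Definition _ (K : fieldType) (M : lmodType K) :=
  [Choice of laurent M by <:].
HB.instance Definition _ (K : fieldType) (M : lmodType K) :=
  [SubChoice_isSubLmodule of laurent M by <:].

Lemma laurent_bound (K : fieldType) (M : lmodType K) (f : laurent M) :
  exists N : int, forall n : int, n < N -> f n = 0.
Proof. exact/asboolP/(coefP f). Qed.

Lemma laurent_ext (K : fieldType) (M : lmodType K) (f g : laurent M) :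
  (forall n, f n = g n) -> f = g.
Proof. by move=> h; apply: val_inj; apply/funext. Qed.

Lemma coef_linear (K : fieldType) (M : lmodType K) (n : int) :
  linear (fun f : laurent M => f n).
Proof. by []. Qed.

(* [\sum_(i \in A) F i] is the sum of a finitely supported family. *)
Lemma fsum_nat (M : zmodType) (F : nat -> M) (N : nat) :
  (forall k, (N <= k)%N -> F k = 0) ->
  \sum_(k \in [set: nat]) F k = \sum_(k < N) F k.
Proof.
move=> h; rewrite fsbig_ord; apply/esym/fsbig_widen => // k [_ /= kN].
by apply: h; rewrite leqNgt; apply/negP.
Qed.

Lemma fsum_int (M : zmodType) (F : int -> M) (A : int) (p : nat) :
  (forall i, i < A -> F i = 0) -> (forall i, A + p%:Z <= i -> F i = 0) ->
  \sum_(i \in [set: int]) F i = \sum_(k < p) F (A + k%:Z).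
Proof.
move=> h1 h2; rewrite (fsbig_ord _ p (fun k => F (A + k%:Z))).
  rewrite -(fsbig_image _ (fun k : nat => A + k%:Z) F).
    apply/esym/fsbig_widen => // i [_ /= ni].
  have [Ai|iA] := leP A i; last exact: h1.
  apply: h2; rewrite leNgt; apply/negP => iAp; apply: ni.
  have d0 : 0 <= i - A by rewrite subr_ge0.
  exists `|i - A|%N; last by rewrite /= gez0_abs // subrKC.
  by rewrite /= -ltz_nat gez0_abs // ltrBlDl.
by move=> i j _ _ /addrI [].
Qed.

Lemma fsum_linear (K : fieldType) (M : lmodType K) (I : choiceType)
    (F G : I -> M) (c : K) :
  finite_set [set i | F i <> 0] -> finite_set [set i | G i <> 0] ->
  \sum_(i \in [set: I]) (c *: F i + G i) =
  c *: (\sum_(i \in [set: I]) F i) + \sum_(i \in [set: I]) G i.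
Proof.
move=> fF fG; pose S := [set i | F i <> 0] `|` [set i | G i <> 0].
have fS : finite_set S by rewrite finite_setU.
have HF i : ~ S i -> F i = 0 by move=> nS; apply: contrapT => h; apply: nS; left.
have HG i : ~ S i -> G i = 0 by move=> nS; apply: contrapT => h; apply: nS; right.
have E (H : I -> M) : (forall i, ~ S i -> H i = 0) ->
    \sum_(i \in [set: I]) H i = \sum_(i <- fset_set S) H i.
  move=> hH; rewrite -fsbig_finite //; apply/esym/fsbig_widen => // i [_ nS].
  exact: hH.
rewrite (E _ HF) (E _ HG) E ?big_split ?scaler_sumr //.
by move=> i nS; rewrite HF // HG // scaler0 addr0.
Qed.

Lemma finite_itv_int (A B : int) : finite_set [set i : int | A <= i < B].
Proof.
apply: (@sub_finite_set _ _ ((fun k : nat => A + k%:Z) @` `I_(`|B - A|%N))).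
  move=> i /= /andP [Ai iB].
  have d0 : 0 <= i - A by rewrite subr_ge0.
  have d1 : 0 <= B - A by rewrite subr_ge0 ltW // (le_lt_trans Ai).
  exists `|i - A|%N; last by rewrite /= gez0_abs // subrKC.
  by rewrite /= -ltz_nat !gez0_abs // ltrD2r.
exact: finite_image.
Qed.

Section LaurentSeries.
Variable K : numFieldType.

(* C((z)), with K in the role of C *)
Definition lseries : lmodType K := laurent (K^o : lmodType K).

(* C((z))[[x]]: the coefficient of x^k is the value at k. *)
Definition lpseries : lmodType K := (nat -> lseries : lmodType K).

Definition lone_fun (n : int) : K^o := if n == 0 then 1 else 0.
Lemma lone_subproof : lone_fun \in @laurent_pred K K^o.
Proof. by apply/asboolP; exists 0 => n; rewrite /lone_fun; case: ltgtP. Qed.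
Definition lone : lseries := Laurent lone_subproof.

Definition lmul_fun (f g : lseries) (n : int) : K^o :=
  \sum_(i \in [set: int]) (f i * g (n - i)).
Lemma lmul_subproof f g : lmul_fun f g \in @laurent_pred K K^o.
Proof.
apply/asboolP; have [N hN] := laurent_bound f; have [P hP] := laurent_bound g.
exists (N + P) => n nNP; apply: fsbig1 => i _.
have [iN|Ni] := ltP i N; first by rewrite hN // mul0r.
by rewrite hP ?mulr0 // ltrBlDl (lt_le_trans nNP) // lerD2r.
Qed.
Definition lmul (f g : lseries) : lseries := Laurent (lmul_subproof f g).

Definition lderiv_fun (f : lseries) (n : int) : K^o := (n + 1)%:~R * f (n + 1).
Lemma lderiv_subproof f : lderiv_fun f \in @laurent_pred K K^o.
Proof.
apply/asboolP; have [N hN] := laurent_bound f.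
by exists (N - 1) => n; rewrite ltrBrDr /lderiv_fun => /hN ->; rewrite mulr0.
Qed.
Definition lderiv (f : lseries) : lseries := Laurent (lderiv_subproof f).

(* f(z+x) = e^{x d/dz} f(z) *)
Definition lshift (f : lseries) : lpseries :=
  fun k => (k`!%:R : K)^-1 *: iter k lderiv f.

Lemma lmul_coef (f g : lseries) (n : int) : lmul f g n = lmul_fun f g n.
Proof. by []. Qed.

Lemma lmul_finite (f g : lseries) (n : int) :
  finite_set [set i : int | f i * g (n - i) <> 0].
Proof.
have [N hN] := laurent_bound f; have [P hP] := laurent_bound g.
apply: sub_finite_set (finite_itv_int N (n - P + 1)) => i /= h.
apply/andP; split.
  by rewrite leNgt; apply/negP => iN; apply: h; rewrite hN // mul0r.
rewrite ltzD1 leNgt; apply/negP => iP; apply: h.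
by rewrite hP ?mulr0 // ltrBlDr -ltrBlDl.
Qed.

Lemma lmul_bilinear : bilinear_map lmul.
Proof.
split=> [g|f] c x y; apply: laurent_ext => n;
  rewrite -[RHS]/(c *: lmul_fun _ _ n + lmul_fun _ _ n)
    -[LHS]/(lmul_fun _ _ n) /lmul_fun -fsum_linear;
  try exact: lmul_finite; apply: eq_fsbigr => i _.
- by rewrite -[(c *: x + y) i]/(c * x i + y i) mulrDl -mulrA.
- by rewrite -[(c *: x + y) _]/(c * x (n - i) + y (n - i)) mulrDr mulrCA.
Qed.

Lemma lderiv_linear : linear lderiv.
Proof.
move=> c f g; apply: laurent_ext => n.
rewrite -[LHS]/((n + 1)%:~R * (c * f (n + 1) + g (n + 1))).
by rewrite mulrDr mulrCA.
Qed.

Lemma lshift_linear : linear lshift.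
Proof.
move=> c f g; apply/funext => k.
rewrite -[RHS]/(c *: lshift f k + lshift g k) /lshift.
have -> : iter k lderiv (c *: f + g) = c *: iter k lderiv f + iter k lderiv g.
  by elim: k => [//|k IH]; rewrite !iterS IH lderiv_linear.
by rewrite scalerDr !scalerA mulrC.
Qed.

End LaurentSeries.

Section LSeriesTensor.
Variables (K : numFieldType) (V : lmodType K).

Definition ltensor : lmodType K := tensor (lseries K) V.

(* 1 (x) v *)
Definition linj (v : V) : ltensor := tens (lone K) v.

(* multiplication by f(z) *)
Definition lact (f : lseries K) : ltensor -> ltensor := tmap (lmul f) id.

(* d/dz (x) 1 *)
Definition tderiv : ltensor -> ltensor := tmap (@lderiv K) id.

(* For t = B(z)v this is B(z+x)v, in C((z))[[x]] (x) V. *)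
Definition tshift : ltensor -> tensor (lpseries K) V := tmap (@lshift K) id.

(* 1 (x) h *)
Definition tcoef (h : V -> V) : ltensor -> ltensor := tmap id h.

(* the C((z))-linear extension of A : V -> C((z)) (x) V *)
Definition lext (A : V -> ltensor) : ltensor -> ltensor :=
  tlift (fun f v => lact f (A v)).

Definition lpow (a : V -> ltensor) (k : nat) (v : V) : ltensor :=
  iter k (lext a) (linj v).

Definition lexp (a : V -> ltensor) (v : V) : ltensor :=
  \sum_(k \in [set: nat]) (k`!%:R : K)^-1 *: lpow a k v.

(* a(z)a(x) = a(x)a(z) as maps V -> C((z)) (x) (C((x)) (x) V): on the left,
   a(x)v = sum_j g_j(x) (x) w_j is sent to the sum over j of
   sum_i f_ij(z) (x) (g_j(x) (x) v_ij), where a(z)w_j = sum_i f_ij(z) (x) v_ij;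
   on the right, a(x) is applied to the V-factor of a(z)v. *)
Definition self_commuting (a : V -> ltensor) : Prop :=
  forall v : V,
    tlift (fun (g : lseries K) (w : V) => tmap id (tens g) (a w)) (a v) =
    tmap id a (a v) :> tensor (lseries K) ltensor.

Lemma linear_idfun (U : lmodType K) : linear (@id U).
Proof. by []. Qed.

Lemma tmap_linear (U1 U2 V1 V2 : lmodType K) (f : U1 -> U2) (g : V1 -> V2) :
  linear f -> linear g -> linear (tmap f g).
Proof. by move=> lf lg; apply/tlift_linear/tmap_bilinear. Qed.

Lemma tmapE (U1 U2 V1 V2 : lmodType K) (f : U1 -> U2) (g : V1 -> V2) u v :
  linear f -> linear g -> tmap f g (tens u v) = tens (f u) (g v).
Proof. by move=> lf lg; rewrite /tmap tliftE //; exact: tmap_bilinear. Qed.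

Lemma lact_bilinear : bilinear_map lact.
Proof.
split=> [t|f]; last by apply: tmap_linear => //; apply: (lmul_bilinear K).2.
move=> c f g; have lm h := (lmul_bilinear K).2 h.
have lt h : linear (lact h) by apply: tmap_linear.
have lt' : linear (fun s => c *: lact f s + lact g s).
  move=> d x y; rewrite !lt !scalerDr !scalerA [c * d]mulrC.
  by rewrite -!scalerA addrACA.
apply: (tlift_unique (lt _) lt') => h v.
by rewrite /lact !tmapE // (lmul_bilinear K).1 (tens_bilinear _ _).1.
Qed.

Lemma lext_bilinear (A : V -> ltensor) :
  linear A -> bilinear_map (fun f v => lact f (A v)).
Proof.
move=> lA; split=> [v|f] c x y; first by rewrite lact_bilinear.1.
by rewrite lA lact_bilinear.2.
Qed.

Lemma self_commuting_bilinear (a : V -> ltensor) : linear a ->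
  bilinear_map (fun (g : lseries K) (w : V) =>
    tmap id (tens g) (a w) : tensor (lseries K) ltensor).
Proof.
move=> la; have lt g := (tens_bilinear (lseries K) V).2 g.
split=> [w|g] c x y; last by rewrite la tmap_linear.
have lm h : linear (tmap id (tens h) : ltensor -> tensor (lseries K) ltensor).
  exact: tmap_linear.
have lm' : linear (fun t : ltensor => c *: (tmap id (tens x) t : tensor (lseries K) ltensor)
    + tmap id (tens y) t).
  move=> d s t; rewrite !lm !scalerDr !scalerA [c * d]mulrC.
  by rewrite -!scalerA addrACA.
apply: (tlift_unique (lm _) lm') => h v.
by rewrite !tmapE // (tens_bilinear _ _).1 (tens_bilinear _ _).2.
Qed.

End LSeriesTensor.

(* C(l, i) for an integer l *)
Definition binz (K : numFieldType) (l : int) (i : nat) : K :=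
  (\prod_(j < i) (l%:~R - j%:R)) / i`!%:R.

(* Y u w is the series Y(u,x)w in V((x)); its coefficient at n is that of x^n,
   so the mode u_n sends w to [Y u w (- n - 1)]. *)
Definition mode (K : numFieldType) (V : lmodType K) (Y : V -> V -> laurent V)
    (u : V) (n : int) (w : V) : V := Y u w (- n - 1).

(* [va_borcherds] is the component form of the Jacobi identity; its two sums
   are finitely supported because Y takes values in V((x)). *)
Record vertexAlgebra (K : numFieldType) (V : lmodType K) := VertexAlgebra {
  vac : V;
  Y : V -> V -> laurent V;
  va_bilinear : bilinear_map Y;
  va_vacuum : forall (w : V) (n : int), mode Y vac n w = if n == -1 then w else 0;
  va_creation : forall u : V, mode Y u (-1) vac = u;
  va_creation_reg : forall (u : V) (n : int), 0 <= n -> mode Y u n vac = 0;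
  va_borcherds : forall (u v w : V) (l m n : int),
    \sum_(i \in [set: nat]) ((-1) ^+ i * binz K l i) *:
       (mode Y u (m + l - i%:Z) (mode Y v (n + i%:Z) w)
        - (-1) ^ l *: mode Y v (n + l - i%:Z) (mode Y u (m + i%:Z) w)) =
    \sum_(i \in [set: nat]) binz K m i *:
       mode Y (mode Y u (l + i%:Z) v) (m + n - i%:Z) w }.

Section Pseudo.
Variables (K : numFieldType) (V : lmodType K) (VA : vertexAlgebra V).

Definition canD (v : V) : V := mode (Y VA) v (-2) (vac VA).

(* The coefficient of x^n in Y(u,x)t, for Y(u,x) extended C((z))-linearly to
   C((z)) (x) V. *)
Definition Yz (u : V) (n : int) : ltensor V -> ltensor V :=
  tcoef (fun w => Y VA u w n).

(* The coefficient of x^n in Y(P,x)t, for Y(.,x) extended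
   C((z))[[x]]-linearly: Y(F(z,x) (x) u, x) = F(z,x) Y(u,x). *)
Definition Yzx (P : tensor (lpseries K) V) (n : int) (t : ltensor V) :
    ltensor V :=
  tlift (fun (F : lpseries K) (u : V) =>
    \sum_(k \in [set: nat]) lact (F k) (Yz u (n - k%:Z) t)) P.

(* [a, Y(u,x)]w and Y(a(z+x)u,x)w are compared at each power x^n. *)
Definition pseudoderivation (a : V -> ltensor V) : Prop :=
  [/\ linear a,
      forall v : V, tcoef canD (a v) - a (canD v) = - tderiv (a v)
    & forall (u w : V) (n : int),
        a (Y VA u w n) - Yz u n (a w) = Yzx (tshift (a u)) n (linj w)].

Definition pseudoendomorphism (A : V -> ltensor V) : Prop :=
  [/\ linear A,
      A (vac VA) = linj (vac VA),
      forall v : V, tcoef canD (A v) - A (canD v) = - tderiv (A v)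
    & forall (v w : V) (n : int),
        A (Y VA v w n) = Yzx (tshift (A v)) n (A w)].

Definition pseudoautomorphism (A : V -> ltensor V) : Prop :=
  pseudoendomorphism A /\
  exists B : V -> ltensor V,
    [/\ linear B,
        forall v : V, lext A (B v) = linj v
      & forall v : V, lext B (A v) = linj v].

Lemma canD_linear : linear canD.
Proof. by move=> c u v; rewrite /canD /mode (va_bilinear VA).1. Qed.

Lemma Yz_coef_linear u n : linear (fun w => Y VA u w n).
Proof. by move=> c v w; rewrite (va_bilinear VA).2. Qed.

Lemma Yz_linear u n : linear (Yz u n).
Proof. by apply: tmap_linear => //; apply: Yz_coef_linear. Qed.

Lemma Yz_linear_l n t : linear (fun u => Yz u n t).
Proof.
move=> c u v; have lt : linear (fun t => c *: Yz u n t + Yz v n t).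
  move=> d x y; rewrite !Yz_linear !scalerDr !scalerA [c * d]mulrC.
  by rewrite -!scalerA addrACA.
apply: (tlift_unique (Yz_linear _ _) lt) => f w.
rewrite /Yz /tcoef !tmapE //; try exact: Yz_coef_linear.
by rewrite (va_bilinear VA).1 -(tens_bilinear _ _).2.
Qed.

Lemma Yz_bound u t : exists N : int, forall n, n < N -> Yz u n t = 0.
Proof.
have [s ->] := tensor_sumE t; elim: s => [|p s [N hN]].
  by exists 0 => n _; rewrite big_nil (linear_fun0 (Yz_linear u n)).
have [P hP] := laurent_bound (Y VA u p.2).
exists (Num.min N P) => n; rewrite lt_min => /andP [nN nP].
rewrite big_cons (linear_funD (Yz_linear u n)) hN // addr0.
rewrite /Yz /tcoef tmapE //.
  by rewrite hP // (linear_fun0 ((tens_bilinear _ _).2 _)).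
exact: Yz_coef_linear.
Qed.

Lemma Yzx_finite (F : lpseries K) u n t :
  finite_set [set k : nat | lact (F k) (Yz u (n - k%:Z) t) <> 0].
Proof.
have [N hN] := Yz_bound u t.
apply: sub_finite_set (finite_II `|n - N|.+1) => k /= h.
rewrite ltnS leqNgt; apply/negP => kn; apply: h.
rewrite hN ?(linear_fun0 ((lact_bilinear V).2 _)) //.
by rewrite ltrBlDl -ltrBlDr (le_lt_trans (ler_norm _)).
Qed.

Lemma Yzx_bilinear n t : bilinear_map (fun (F : lpseries K) (u : V) =>
  \sum_(k \in [set: nat]) lact (F k) (Yz u (n - k%:Z) t)).
Proof.
split=> [u|F] c x y; rewrite -fsum_linear; try exact: Yzx_finite;
  apply: eq_fsbigr => k _.
  by rewrite -[(c *: x + y) k]/(c *: x k + y k) (lact_bilinear V).1.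
by rewrite Yz_linear_l (lact_bilinear V).2.
Qed.

End Pseudo.

(* Main.v *)
Require Import Defs.
From mathcomp Require Import all_boot all_order all_algebra.
From mathcomp Require Import boolp classical_sets cardinality fsbigop.
From mathcomp Require Import reals.
From mathcomp.real_closed Require Import complex.

Set Implicit Arguments.
Unset Strict Implicit.
Unset Printing Implicit Defensive.

Import Order.TTheory GRing.Theory Num.Theory.

Local Open Scope classical_set_scope.
Local Open Scope ring_scope.

(** Write [T] for the C((z))-linear endomorphism [lext a] of C((z)) (x) V that
    extends [a].  The two pseudoderivation axioms say that [T] is a derivation
    of all the structure in sight:
    - it commutes with the total derivative D + d/dz ([total_deriv_commute]);
    - T (Y(s(z+x),x)t) = Y((T s)(z+x),x)t + Y(s(z+x),x)(T t) for all s, t in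
      C((z)) (x) V ([lext_Yzx]).
    The second rule starts as an identity about vectors of V.  It extends to
    coefficients in C((z)) because f(z) |-> f(z+x) is a ring morphism
    ([lseries_shiftM]), so that s |-> s(z+x) turns multiplication by f(z) into
    multiplication by f(z+x) ([Yzx_tshift_lact]).

    Nilpotence on the vectors of V makes [T] locally nilpotent, and the
    exponential of a locally nilpotent derivation is multiplicative: the
    divided powers T^k/k! obey T^k/k! (s.t) = sum_(i+j=k) (T^i/i! s).(T^j/j! t),
    and summing over k gives exp(T)(s.t) = (exp(T)s).(exp(T)t).  Taking for the
    product s.t a coefficient of Y(s(z+x),x)t yields the relation
    A(z)Y(v,x) = Y(A(z+x)v,x)A(z).  Commutation with D + d/dz passes to each
    power of [T], and a(z)1 = 0, by the creation axiom, gives A(z)1 = 1.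
    Finally exp(-a(z)) is the inverse of exp a(z), as exp(T)exp(-T) = 1 for a
    locally nilpotent [T] ([expopN]).

    One combinatorial lemma, [leibniz_divpow], serves three times: for
    f(z+x)g(z+x) = (fg)(z+x), where T = d/dz; for the multiplicativity of
    exp(T); and for exp(T)exp(-T) = 1, where the derivation is zero. *)

(** * Finitely supported sums *)

Section Sums.
Variable M : zmodType.

(** [exchange_fsbig] asks for finite index sets; here finitely many nonzero
    terms suffice. *)
Lemma exchange_fsum (I J : choiceType) (P : set I) (Q : set J)
    (F : I -> J -> M) :
  finite_set P -> finite_set Q ->
  (forall i j, F i j <> 0 -> P i /\ Q j) ->
  \sum_(i \in [set: I]) \sum_(j \in [set: J]) F i j =
  \sum_(j \in [set: J]) \sum_(i \in [set: I]) F i j.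
Proof.
move=> fP fQ PQ.
have F0 i j : ~ (P i /\ Q j) -> F i j = 0.
  by move=> nPQ; apply: contrapT => /PQ.
have rI (G : I -> M) : (forall i, ~ P i -> G i = 0) ->
    \sum_(i \in [set: I]) G i = \sum_(i \in P) G i.
  by move=> G0; apply/esym/fsbig_widen => // i [_ /G0].
have rJ (G : J -> M) : (forall j, ~ Q j -> G j = 0) ->
    \sum_(j \in [set: J]) G j = \sum_(j \in Q) G j.
  by move=> G0; apply/esym/fsbig_widen => // j [_ /G0].
rewrite rI; last by move=> i nP; apply: fsbig1 => j _; apply: F0 => -[].
rewrite rJ; last by move=> j nQ; apply: fsbig1 => i _; apply: F0 => -[].
under eq_fsbigr => i _ do rewrite (rJ _ (fun j nQ => F0 i j (fun h => nQ h.2))).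
under [RHS]eq_fsbigr => j _ do
  rewrite (rI _ (fun i nP => F0 i j (fun h => nP h.1))).
exact: exchange_fsbig.
Qed.

(** Both sides add up the same finite array, the left one along its
    antidiagonals.  The antidiagonal sums are how products of power series and
    divided powers of a derivation present themselves, the iterated sums are
    how products of exponentials do. *)
Lemma cauchy_sum (H : nat -> nat -> M) (N : nat) :
  (forall i j, (N <= i)%N || (N <= j)%N -> H i j = 0) ->
  \sum_(k \in [set: nat]) \sum_(i < k.+1) H i (k - i)%N =
  \sum_(i \in [set: nat]) \sum_(j \in [set: nat]) H i j.
Proof.
(* An antidiagonal of index at least 2N has one coordinate at least N
   everywhere, so all sums may be cut at 2N. *)
move=> H0; rewrite (fsum_nat (N := N + N)); last first.
  move=> k kN; apply: big1 => i _; apply: H0; apply/orP.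
  have [Ni|iN] := leqP N i; first by left.
  by right; apply: leq_trans (leq_sub kN (ltnW iN)); rewrite addnK.
rewrite (fsum_nat (N := N + N)); last first.
  move=> i iN; apply: fsbig1 => j _; apply: H0.
  by rewrite (leq_trans (leq_addr N N)).
under eq_bigr => k _ do
  rewrite (big_ord_widen (N + N) (fun i => H i (k - i)%N) (ltn_ord k)).
(* For a fixed row i, the entries k - i with i <= k < 2N are all those that
   can be nonzero. *)
rewrite (exchange_big_dep predT) //=; apply: eq_bigr => i _.
rewrite (fsum_nat (N := N + N - i)); last first.
  move=> j; rewrite leq_subLR => ij; apply: H0.
  by case: leqP => //= iN; rewrite -(leq_add2l N) (leq_trans ij) // leq_add2r ltnW.
rewrite -(big_mkord xpredT (fun j => H i j)).
rewrite -(big_mkord (fun k => i < k.+1)%N (fun k => H i (k - i)%N)).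
rewrite (big_cat_nat (n := i)) //= ?(ltnW (ltn_ord _)) //.
rewrite big_nat_cond big1 ?add0r; last first.
  by move=> k /andP [/andP [_ ki]]; rewrite ltnS leqNgt ki.
rewrite -{1}[i : nat]add0n big_addn big_nat_cond [RHS]big_nat_cond.
apply: eq_big => [k|k _]; last by rewrite addnK.
by rewrite ltnS leq_addl.
Qed.

Lemma finite_support_nat (F : nat -> M) (N : nat) :
  (forall k, (N <= k)%N -> F k = 0) -> finite_set [set k | F k <> 0].
Proof.
move=> F0; apply: sub_finite_set (finite_II N) => k /= Fk.
by rewrite ltnNge; apply/negP => /F0.
Qed.

(** A lower bound on the exponents of a Laurent series makes every sum over
    the indices n - k with k >= 0 finite. *)
Lemma eventually_nat (F : int -> M) (n : int) :
  (exists N : int, forall m, m < N -> F m = 0) ->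
  exists N : nat, forall k, (N <= k)%N -> F (n - k%:Z) = 0.
Proof.
move=> [N hN]; exists `|n - N|.+1 => k nk; apply: hN.
by rewrite ltrBlDl -ltrBlDr (le_lt_trans (ler_norm _)).
Qed.

End Sums.

Lemma linear_fsum_nat (K : fieldType) (M N : lmodType K) (f : M -> N)
    (F : nat -> M) (n : nat) :
  linear f -> (forall k, (n <= k)%N -> F k = 0) ->
  f (\sum_(k \in [set: nat]) F k) = \sum_(k \in [set: nat]) f (F k).
Proof.
move=> lf F0; rewrite (fsum_nat F0) (Defs.linear_sum lf).
by rewrite (fsum_nat (N := n)) // => k /F0 ->; exact: linear_fun0.
Qed.

(** * Exponentials of locally nilpotent operators *)

Section Exponential.
Variables (K : numFieldType) (M : lmodType K).

Definition divpow (T : M -> M) (k : nat) (x : M) : M :=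
  (k`!%:R : K)^-1 *: iter k T x.

Definition expop (T : M -> M) (x : M) : M := \sum_(k \in [set: nat]) divpow T k x.

Definition locally_nilpotent (T : M -> M) : Prop :=
  forall x, exists N, forall k, (N <= k)%N -> iter k T x = 0.

Lemma natf_neq0 k : (k.+1%:R : K) != 0.
Proof. by rewrite pnatr_eq0. Qed.

Lemma divpow0 T x : divpow T 0 x = x.
Proof. by rewrite /divpow fact0 invr1 scale1r. Qed.

Lemma iter_linear (T : M -> M) k : linear T -> linear (iter k T).
Proof. by move=> lT c x y; elim: k => // k IH; rewrite !iterS IH lT. Qed.

Lemma divpow_linear (T : M -> M) k : linear T -> linear (divpow T k).
Proof.
move=> lT c x y; rewrite /divpow (iter_linear k lT) scalerDr !scalerA.
by rewrite [c * _]mulrC.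
Qed.

Lemma divpowS (T : M -> M) k x : linear T ->
  T (divpow T k x) = k.+1%:R *: divpow T k.+1 x.
Proof.
move=> lT; rewrite /divpow (linear_funZ lT) scalerA factS natrM invfM mulrA.
by rewrite divff ?natf_neq0 // mul1r.
Qed.

(** The Leibniz rule for divided powers, with [G i j] in the role of the
    product (T1^i/i! s).(T2^j/j! t) of two divided powers.  Stating the rule
    for a bare array [G], and not for a bilinear product, lets it also apply
    to the composition of two operators, as in [expopN].  By induction on k:
    in T of the k-th sum, the term G i (k+1-i) arises with coefficient i from
    the first half of the hypothesis and k+1-i from the second, in total k+1
    for every i. *)
Lemma leibniz_divpow (T : M -> M) (G : nat -> nat -> M) : linear T ->
  (forall i j, T (G i j) = i.+1%:R *: G i.+1 j + j.+1%:R *: G i j.+1) ->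
  forall k, divpow T k (G 0 0) = \sum_(i < k.+1) G i (k - i)%N.
Proof.
move=> lT TG; elim=> [|k IH]; first by rewrite divpow0 big_ord1.
apply: (scalerI (natf_neq0 k)).
rewrite -divpowS // IH (Defs.linear_sum lT).
under eq_bigr do rewrite TG.
rewrite big_split /=.
transitivity (\sum_(i < k.+2) (i%:R : K) *: G i (k.+1 - i)%N +
              \sum_(i < k.+2) ((k.+1 - i)%N%:R : K) *: G i (k.+1 - i)%N).
  congr (_ + _).
    rewrite [RHS]big_ord_recl mulr0n scale0r add0r; apply: eq_bigr => i _.
    by rewrite lift0 subSS.
  rewrite [RHS]big_ord_recr /= subnn scale0r addr0; apply: eq_bigr => i _.
  by rewrite subSn // -ltnS.
rewrite -big_split scaler_sumr; apply: eq_bigr => i _ /=.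
by rewrite -scalerDl -natrD subnKC // -ltnS.
Qed.

Lemma divpow_nilpotent (T : M -> M) : locally_nilpotent T ->
  forall x, exists N, forall k, (N <= k)%N -> divpow T k x = 0.
Proof.
move=> nT x; have [N hN] := nT x; exists N => k /hN Tk.
by rewrite /divpow Tk scaler0.
Qed.

Lemma expop_linear (T : M -> M) : linear T -> locally_nilpotent T ->
  linear (expop T).
Proof.
move=> lT nT c x y; have [N hN] := divpow_nilpotent nT x.
have [P hP] := divpow_nilpotent nT y.
rewrite /expop -fsum_linear; first by apply: eq_fsbigr => k _; rewrite divpow_linear.
- exact: finite_support_nat hN.
- exact: finite_support_nat hP.
Qed.

(** The exponential of a derivation is multiplicative: when G factors as in
    [leibniz_divpow], the right-hand side is the product of two
    exponentials. *)
Lemma expop_leibniz (T : M -> M) (G : nat -> nat -> M) (N : nat) : linear T ->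
  (forall i j, T (G i j) = i.+1%:R *: G i.+1 j + j.+1%:R *: G i j.+1) ->
  (forall i j, (N <= i)%N || (N <= j)%N -> G i j = 0) ->
  expop T (G 0 0) = \sum_(i \in [set: nat]) \sum_(j \in [set: nat]) G i j.
Proof.
move=> lT TG G0; rewrite -(cauchy_sum G0) /expop.
by apply: eq_fsbigr => k _; rewrite leibniz_divpow.
Qed.

Lemma iterN (T : M -> M) k x : linear T ->
  iter k (fun y => - T y) x = (-1) ^+ k *: iter k T x.
Proof.
move=> lT; elim: k => [|k IH]; first by rewrite scale1r.
by rewrite !iterS IH (linear_funZ lT) exprS mulN1r scaleNr.
Qed.

Lemma locally_nilpotentN (T : M -> M) : linear T -> locally_nilpotent T ->
  locally_nilpotent (fun y => - T y).
Proof.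
move=> lT nT y; have [N hN] := nT y; exists N => k /hN.
by rewrite iterN // => ->; rewrite scaler0.
Qed.

Lemma divpowC (T : M -> M) k x : linear T ->
  divpow T k (T x) = T (divpow T k x).
Proof. by move=> lT; rewrite /divpow (linear_funZ lT) -iterS iterSr. Qed.

(** The divided powers of [T] and of its opposite form an array that
    satisfies the Leibniz hypothesis for the zero operator, because the two
    halves of that hypothesis are T G i j and its opposite.  The exponential
    of zero being the identity, [expop_leibniz] gives the claim. *)
Lemma expopN (T : M -> M) x : linear T -> locally_nilpotent T ->
  expop T (expop (fun y => - T y) x) = x.
Proof.
move=> lT nT; pose T' := fun y : M => - T y.
have lT' : linear T' by move=> c y z; rewrite /T' lT opprD scalerN.
pose G i j := divpow T i (divpow T' j x).
have [N hN] := nT x.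
have TT' i j : iter i T (iter j T' x) = (-1) ^+ j *: iter (i + j) T x.
  by rewrite iterN // iterD; exact/linear_funZ/iter_linear.
have G0 i j : (N <= i)%N || (N <= j)%N -> G i j = 0.
  move=> ij; rewrite /G /divpow (linear_funZ (iter_linear i lT)) TT' hN ?scaler0 //.
  by case/orP: ij => h; apply: leq_trans h _; rewrite ?leq_addr ?leq_addl.
have G0' j : (N <= j)%N -> divpow T' j x = 0.
  by move=> Nj; have := G0 0%N j; rewrite /G divpow0 Nj orbT; exact.
have TG i j : (fun=> 0) (G i j) = i.+1%:R *: G i.+1 j + j.+1%:R *: G i j.+1.
  have dT y : divpow T i (T' y) = - T (divpow T i y).
    by rewrite /T' -scaleN1r (linear_funZ (divpow_linear i lT)) divpowC // scaleN1r.
  transitivity (T (G i j) + divpow T i (T' (divpow T' j x))).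
    by rewrite dT subrr.
  congr (_ + _); first by rewrite /G divpowS.
  by rewrite divpowS // (linear_funZ (divpow_linear i lT)).
rewrite [X in expop T X]/expop (linear_fsum_nat (expop_linear lT nT) G0').
transitivity (\sum_(i \in [set: nat]) \sum_(j \in [set: nat]) G i j).
  rewrite (exchange_fsum (P := `I_N) (Q := `I_N)) //.
  move=> i j Gij /=; split; rewrite ltnNge; apply/negP => h; apply: Gij.
    by apply: G0; rewrite h orbT.
  by apply: G0; rewrite h.
rewrite -(expop_leibniz (T := fun=> 0) (N := N)) //; last first.
  by move=> c y z; rewrite scaler0 addr0.
rewrite /expop (fsum_nat (N := 1)); last first.
  by case=> // k _; rewrite /divpow scaler0.
by rewrite big_ord1 /G !divpow0.
Qed.

End Exponential.

(** * The ring C((z)) and the Taylor shift *)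

Section LaurentAlgebra.
Variable K : numFieldType.
Implicit Types f g h : lseries K.

Lemma lmulC f g : lmul f g = lmul g f.
Proof.
apply: laurent_ext => n; rewrite !lmul_coef /lmul_fun.
rewrite (reindex_fsbigT (fun i : int => n - i)); last first.
  by exists (fun i : int => n - i) => i; rewrite subKr.
by apply: eq_fsbigr => i _; rewrite subKr mulrC.
Qed.

Lemma lmul1 f : lmul (lone K) f = f.
Proof.
apply: laurent_ext => n; rewrite lmul_coef /lmul_fun.
rewrite (fsum_int (A := 0) (p := 1)).
- by rewrite big_ord1 /= /lone_fun addr0 eqxx mul1r subr0.
- by move=> i i0; rewrite /= /lone_fun lt_eqF // mul0r.
- by move=> i i0; rewrite /= /lone_fun gt_eqF ?mul0r // (lt_le_trans _ i0).
Qed.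

(** The double sum over i and j of f_i g_(j-i) h_(n-j), in its two orders. *)
Lemma lmulA f g h : lmul f (lmul g h) = lmul (lmul f g) h.
Proof.
apply: laurent_ext => n; rewrite !lmul_coef /lmul_fun.
have [A hA] := laurent_bound f; have [B hB] := laurent_bound g.
have [C hC] := laurent_bound h.
transitivity (\sum_(i \in [set: int]) \sum_(j \in [set: int])
    (f i * g (j - i) * h (n - j))).
  apply: eq_fsbigr => i _; rewrite lmul_coef /lmul_fun.
  rewrite (reindex_fsbigT (fun j : int => j - i)); last first.
    by exists (fun j : int => j + i) => j; rewrite ?addrK ?subrK.
  rewrite (@mulr_fsumr K); apply: eq_fsbigr => j _.
  by rewrite mulrA; congr (_ * h _); rewrite opprB [n - i + _]addrA subrK.
rewrite (exchange_fsum (P := [set i | A <= i < n - C - B + 1])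
           (Q := [set j | A + B <= j < n - C + 1])).
- apply: eq_fsbigr => j _; rewrite lmul_coef /lmul_fun.
  by rewrite (@mulr_fsuml K).
- exact: finite_itv_int.
- exact: finite_itv_int.
(* A, B, C bound the exponents of f, g, h from below, and the three exponents
   i, j - i, n - j add up to n. *)
move=> i j fgh /=.
have [Ai|iA] := leP A i; last by case: fgh; rewrite hA // !mul0r.
have [Bj|jB] := leP B (j - i); last by case: fgh; rewrite hB // mulr0 mul0r.
have [Cn|nC] := leP C (n - j); last by case: fgh; rewrite hC // mulr0.
have jn : j <= n - C by rewrite lerBrDr addrC -lerBrDr.
have Bij : B + i <= j by rewrite -lerBrDr.
split; apply/andP; split=> //; rewrite ?ltzD1 //.
  by rewrite lerBrDr addrC (le_trans Bij).
by rewrite addrC (le_trans _ Bij) // lerD2l.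
Qed.

Lemma lderivM f g : lderiv (lmul f g) = lmul (lderiv f) g + lmul f (lderiv g).
Proof.
apply: laurent_ext => n.
rewrite -[LHS]/((n + 1)%:~R * lmul_fun f g (n + 1)).
rewrite -[RHS]/(lmul_fun (lderiv f) g n + lmul_fun f (lderiv g) n) /lmul_fun.
rewrite [X in _ = X + _](reindex_fsbigT (fun i : int => i - 1)); last first.
  by exists (fun i : int => i + 1) => i; rewrite ?addrK ?subrK.
rewrite -[X in _ = X + _]scale1r.
rewrite -(@fsum_linear K K^o).
- rewrite (@mulr_fsumr K); apply: eq_fsbigr => i _.
  rewrite scale1r /lderiv /= /lderiv_fun subrK.
  rewrite opprB addrA [n - i + 1]addrAC [f i * (_ * _)]mulrCA -mulrA -mulrDl.
  by rewrite -intrD [i + _]addrC subrK.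
- apply: sub_finite_set (finite_image (fun i => i + 1) (lmul_finite (lderiv f) g n)).
  by move=> i /= fg; exists (i - 1); rewrite ?subrK.
- exact: lmul_finite.
Qed.

Lemma lseries_shift0 f : Defs.lshift f 0 = f.
Proof. exact: divpow0. Qed.

Lemma lderiv_shift f k :
  lderiv (Defs.lshift f k) = k.+1%:R *: Defs.lshift f k.+1.
Proof. exact/divpowS/lderiv_linear. Qed.

(** f(z+x)g(z+x) = (fg)(z+x): the coefficients of the Taylor shift are the
    divided powers of the derivation d/dz. *)
Lemma lseries_shiftM f g k :
  Defs.lshift (lmul f g) k =
  \sum_(i < k.+1) lmul (Defs.lshift f i) (Defs.lshift g (k - i)%N).
Proof.
pose G i j := lmul (Defs.lshift f i) (Defs.lshift g j).
rewrite -[f in LHS]lseries_shift0 -[g in LHS]lseries_shift0.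
apply: (leibniz_divpow (G := G)) => [|i j]; first exact: lderiv_linear.
rewrite lderivM !lderiv_shift.
have [lml lmr] := lmul_bilinear K.
congr (_ + _); first exact: (linear_funZ (lml _)).
exact: (linear_funZ (lmr _)).
Qed.

End LaurentAlgebra.

(** * The C((z))-module C((z)) (x) V and linear extensions *)

Section LaurentTensor.
Variables (K : numFieldType) (V : lmodType K).
Implicit Types (f g : lseries K) (v : V) (t : ltensor V) (a A : V -> ltensor V).

Lemma lact_tens f g v : lact f (tens g v) = tens (lmul f g) v.
Proof. by rewrite /lact tmapE //; exact: (lmul_bilinear K).2. Qed.

Lemma lact_linear f : linear (@lact K V f).
Proof. exact: (lact_bilinear V).2. Qed.

Lemma lact0 f : lact f 0 = 0 :> ltensor V.
Proof. exact/linear_fun0/lact_linear. Qed.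

Lemma lact_linear_l t : linear (fun f => lact f t).
Proof. exact: (lact_bilinear V).1. Qed.

Lemma lactA f g t : lact f (lact g t) = lact (lmul f g) t.
Proof.
move: t; apply: tlift_unique => [c x y||h v]; rewrite ?lact_linear //.
- exact: lact_linear.
- by rewrite !lact_tens lmulA.
Qed.

Lemma lactC f g t : lact f (lact g t) = lact g (lact f t).
Proof. by rewrite !lactA lmulC. Qed.

Lemma lact1 t : lact (lone K) t = t.
Proof.
move: t; apply: tlift_unique => [||h v]; first exact: lact_linear.
  exact: linear_idfun.
by rewrite lact_tens lmul1.
Qed.

Lemma lact_linj f v : lact f (linj v) = tens f v.
Proof. by rewrite lact_tens lmulC lmul1. Qed.

Lemma linj_linear : linear (@linj K V).
Proof. exact: (tens_bilinear _ _).2. Qed.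

Lemma lext_tens A f v : linear A -> lext A (tens f v) = lact f (A v).
Proof. by move=> lA; rewrite /lext tliftE //; exact: lext_bilinear. Qed.

Lemma lext_linear A : linear A -> linear (lext A).
Proof. by move=> lA; apply/tlift_linear/lext_bilinear. Qed.

Lemma lext_linj A v : linear A -> lext A (linj v) = A v.
Proof. by move=> lA; rewrite lext_tens // lact1. Qed.

Lemma lext_lact A f t : linear A -> lext A (lact f t) = lact f (lext A t).
Proof.
move=> lA; move: t; apply: tlift_unique => [c x y|c x y|g v].
- by rewrite lact_linear lext_linear.
- by rewrite lext_linear // lact_linear.
- by rewrite lact_tens !lext_tens // lactA.
Qed.

Lemma iter_lext_lact A k f t : linear A ->
  iter k (lext A) (lact f t) = lact f (iter k (lext A) t).
Proof. by move=> lA; elim: k => // k IH; rewrite !iterS IH lext_lact. Qed.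

(** An element of C((z)) (x) V involves finitely many vectors of V, hence a
    common exponent of nilpotence. *)
Lemma lext_nilpotent A : linear A ->
  (forall v, exists k, lpow A k v = 0) -> locally_nilpotent (lext A).
Proof.
move=> lA nA t; have [s ->] := tensor_sumE t; elim: s => [|p s [N hN]].
  by exists 0%N => k _; rewrite big_nil; exact/linear_fun0/iter_linear/lext_linear.
have [k hk] := nA p.2; exists (N + k)%N => m Nkm.
have lk i := iter_linear i (lext_linear lA).
rewrite big_cons (linear_funD (lk m)) hN ?(leq_trans (leq_addr k N)) // addr0.
rewrite -lact_linj iter_lext_lact //.
rewrite -(subnK (leq_trans (leq_addl N k) Nkm)) iterD -/(lpow A k p.2) hk.
by rewrite (linear_fun0 (lk _)) lact0.
Qed.

Lemma lexp_linear A : linear A -> locally_nilpotent (lext A) -> linear (lexp A).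
Proof.
move=> lA nA c x y; rewrite -[LHS]/(expop _ _) linj_linear.
by rewrite expop_linear //; exact: lext_linear.
Qed.

(** Replaces exp a(z), a sum formed separately for each vector of V, by the
    exponential of one linear operator, to which the general facts about
    [expop] apply. *)
Lemma lext_lexp A t : linear A -> locally_nilpotent (lext A) ->
  lext (lexp A) t = expop (lext A) t.
Proof.
move=> lA nA; move: t; apply: tlift_unique => [||f v].
- exact/lext_linear/lexp_linear.
- by apply: expop_linear => //; exact: lext_linear.
rewrite lext_tens; last exact: lexp_linear.
have [N hN] := divpow_nilpotent nA (linj v).
rewrite [lact _ _](linear_fsum_nat (lact_linear f) hN).
apply: eq_fsbigr => k _; rewrite /divpow (linear_funZ (lact_linear f)).
by rewrite -iter_lext_lact // lact_linj.
Qed.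

Lemma lextN A t : linear A -> lext (fun v => - A v) t = - lext A t.
Proof.
move=> lA; have lN : linear (fun v => - A v).
  by move=> c x y; rewrite lA opprD scalerN.
move: t; apply: tlift_unique => [|c x y|f v]; first exact: lext_linear.
  by rewrite lext_linear // opprD scalerN.
rewrite !lext_tens // -!scaleN1r; exact: (linear_funZ (lact_linear f)).
Qed.

Lemma tshift_linear : linear (@tshift K V).
Proof. by apply: tmap_linear => //; exact: lshift_linear. Qed.

Lemma tshift_tens f v : tshift (tens f v) = tens (Defs.lshift f) v.
Proof. by rewrite /tshift tmapE //; exact: lshift_linear. Qed.

Lemma lderiv1 : lderiv (lone K) = 0.
Proof.
apply: laurent_ext => n; rewrite -[LHS]/((n + 1)%:~R * lone_fun K (n + 1)).
by rewrite /lone_fun; case: eqP => [->|_]; rewrite ?mul0r // mulr0.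
Qed.

Lemma tderiv_linear : linear (@tderiv K V).
Proof. by apply: tmap_linear => //; exact: lderiv_linear. Qed.

Lemma tderiv_lact f t : tderiv (lact f t) = lact (lderiv f) t + lact f (tderiv t).
Proof.
move: t; apply: tlift_unique => [c x y|c x y|g v].
- by rewrite lact_linear tderiv_linear.
- by rewrite tderiv_linear !lact_linear scalerDr addrACA.
rewrite /tderiv !(lact_tens, tmapE) //; try exact: lderiv_linear.
by rewrite lderivM; exact: (linear_funD ((tens_bilinear _ _).1 v)).
Qed.

End LaurentTensor.

(** * The extended operators Y(u,x) and Y(P,x) *)

Section FieldAction.
Variables (K : numFieldType) (V : lmodType K) (VA : vertexAlgebra V).
Implicit Types (f : lseries K) (u v w : V) (s t : ltensor V)
  (P : tensor (lpseries K) V).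

Lemma Yz_tens u n f w : Yz VA u n (tens f w) = tens f (Y VA u w n).
Proof. by rewrite /Yz /tcoef tmapE //; exact: Yz_coef_linear. Qed.

Lemma Yz_lact u n f t : Yz VA u n (lact f t) = lact f (Yz VA u n t).
Proof.
move: t; apply: tlift_unique => [c x y|c x y|g w].
- by rewrite lact_linear Yz_linear.
- by rewrite Yz_linear lact_linear.
- by rewrite !(lact_tens, Yz_tens).
Qed.

Lemma Yzx_tens F u n t : Yzx VA (tens F u) n t =
  \sum_(k \in [set: nat]) lact (F k) (Yz VA u (n - k%:Z) t).
Proof. by rewrite /Yzx tliftE //; exact: Yzx_bilinear. Qed.

Lemma Yzx_linear_l n t : linear (fun P => Yzx VA P n t).
Proof. exact/tlift_linear/Yzx_bilinear. Qed.

Lemma Yzx_linear P n : linear (Yzx VA P n).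
Proof.
move=> c x y; have lr : linear (fun P => c *: Yzx VA P n x + Yzx VA P n y).
  move=> d Q R; rewrite !Yzx_linear_l !scalerDr !scalerA [c * d]mulrC.
  by rewrite -!scalerA addrACA.
move: P; apply: (tlift_unique (Yzx_linear_l n _) lr) => F u.
rewrite !Yzx_tens -fsum_linear; try exact: Yzx_finite.
by apply: eq_fsbigr => k _; rewrite Yz_linear lact_linear.
Qed.

Lemma Yzx_lact P n f t : Yzx VA P n (lact f t) = lact f (Yzx VA P n t).
Proof.
have ll : linear (fun P => lact f (Yzx VA P n t)).
  by move=> c Q R; rewrite Yzx_linear_l lact_linear.
move: P; apply: (tlift_unique (Yzx_linear_l n _) ll) => F u.
have [N hN] := eventually_nat n (Yz_bound VA u t).
rewrite !Yzx_tens (linear_fsum_nat (n := N) (lact_linear f)).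
  by apply: eq_fsbigr => k _; rewrite Yz_lact lactC.
by move=> k /hN ->; exact: lact0.
Qed.

Lemma Yzx_bound P t : exists N : int, forall n, n < N -> Yzx VA P n t = 0.
Proof.
have [s ->] := tensor_sumE P; elim: s => [|p s [N hN]].
  by exists 0 => n _; rewrite big_nil (linear_fun0 (Yzx_linear_l n t)).
have [Q hQ] := Yz_bound VA p.2 t.
exists (Num.min N Q) => n; rewrite lt_min => /andP [nN nQ].
rewrite big_cons (linear_funD (Yzx_linear_l n t)) hN // addr0 Yzx_tens.
apply: fsbig1 => k _; rewrite hQ ?lact0 //.
by rewrite (le_lt_trans _ nQ) // gerBl.
Qed.

(** (f s)(z+x) = f(z+x) s(z+x), read inside Y(_,x)t: the ring morphism property
    of the Taylor shift, with the product of power series in x written out by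
    coefficients. *)
Lemma Yzx_tshift_lact f s n t : Yzx VA (tshift (lact f s)) n t =
  \sum_(k \in [set: nat]) lact (Defs.lshift f k) (Yzx VA (tshift s) (n - k%:Z) t).
Proof.
have fin x : finite_set [set k : nat |
    lact (Defs.lshift f k) (Yzx VA (tshift x) (n - k%:Z) t) <> 0].
  have [N hN] := eventually_nat n (Yzx_bound (tshift x) t).
  by apply: (finite_support_nat (N := N)) => k /hN ->; exact: lact0.
move: s; apply: tlift_unique => [c x y|c x y|g u].
- by rewrite lact_linear tshift_linear Yzx_linear_l.
- rewrite -fsum_linear //; apply: eq_fsbigr => k _.
  by rewrite tshift_linear Yzx_linear_l lact_linear.
have [N hN] := eventually_nat n (Yz_bound VA u t).
pose H i j := lact (Defs.lshift f i)
  (lact (Defs.lshift g j) (Yz VA u (n - (i + j)%N%:Z) t)).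
rewrite lact_tens tshift_tens Yzx_tens.
transitivity (\sum_(k \in [set: nat]) \sum_(i < k.+1) H i (k - i)%N).
  apply: eq_fsbigr => k _.
  rewrite lseries_shiftM (Defs.linear_sum (lact_linear_l _)).
  apply: eq_bigr => i _; have ik : (i <= k)%N by rewrite -ltnS.
  by rewrite /H (subnKC ik) lactA.
rewrite (cauchy_sum (N := N)); last first.
  move=> i j ij; rewrite /H hN ?lact0 //.
  by case/orP: ij => h; apply: leq_trans h _; rewrite ?leq_addr ?leq_addl.
apply: eq_fsbigr => i _; rewrite tshift_tens Yzx_tens.
rewrite [RHS](linear_fsum_nat (n := N) (lact_linear _)).
  by apply: eq_fsbigr => j _; rewrite /H PoszD opprD addrA.
move=> j Nj; rewrite -addrA -opprD -PoszD hN ?lact0 //.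
by rewrite (leq_trans Nj) // leq_addl.
Qed.

Lemma lshift_lone k : Defs.lshift (lone K) k = if k == 0%N then lone K else 0.
Proof.
case: k => [|k]; first exact: divpow0.
rewrite /= /Defs.lshift iterSr lderiv1.
by rewrite (linear_fun0 (iter_linear k (@lderiv_linear K))) scaler0.
Qed.

(** The constant series 1 is invariant under the Taylor shift, so the case
    s = 1 (x) v of Y(s(z+x),x) is the ordinary operator Y(v,x). *)
Lemma Yzx_linj v n t : Yzx VA (tshift (linj v)) n t = Yz VA v n t.
Proof.
rewrite tshift_tens Yzx_tens (fsum_nat (N := 1)).
  by rewrite big_ord1 lshift_lone /= lact1 subr0.
by case=> // k _; rewrite lshift_lone (linear_fun0 (lact_linear_l _)).
Qed.

(** The creation axiom at x = 0: only the Taylor coefficient of order 0 meets a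
    nonnegative power of x. *)
Lemma Yzx_creation t : Yzx VA (tshift t) 0 (linj (vac VA)) = t.
Proof.
have lY : linear (fun t : ltensor V => Yzx VA (tshift t) 0 (linj (vac VA))).
  by move=> c x y; rewrite tshift_linear Yzx_linear_l.
move: t; apply: (tlift_unique lY (@linear_idfun _ _)) => f u.
rewrite tshift_tens Yzx_tens (fsum_nat (N := 1)).
  rewrite big_ord1 lseries_shift0 Yz_tens subr0.
  by rewrite -[Y VA u _ _]/(mode (Y VA) u (-1) (vac VA)) va_creation lact_linj.
case=> // k _; rewrite Yz_tens.
have := va_creation_reg VA u (n := k) isT.
rewrite /mode -opprD -PoszD addn1 sub0r => ->.
by rewrite (linear_fun0 ((tens_bilinear _ _).2 _)) lact0.
Qed.

End FieldAction.

(** * The total derivative D + d/dz *)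

Section TotalDerivative.
Variables (K : numFieldType) (V : lmodType K) (VA : vertexAlgebra V).

(** The relation [D, A(z)] = -(d/dz)A(z) says that [lext A] commutes with this
    operator ([total_deriv_commute]), a form that is stable under powers and
    sums. *)
Definition total_deriv (t : ltensor V) : ltensor V := tcoef (canD VA) t + tderiv t.

Lemma tcoef_canD_linear : linear (tcoef (canD VA)).
Proof. by apply: tmap_linear => //; exact: canD_linear. Qed.

Lemma total_deriv_linear : linear total_deriv.
Proof.
move=> c x y; rewrite /total_deriv tderiv_linear.
by rewrite tcoef_canD_linear scalerDr addrACA.
Qed.

Lemma total_deriv_lact f t :
  total_deriv (lact f t) = lact (lderiv f) t + lact f (total_deriv t).
Proof.
have lD := tcoef_canD_linear.
have DE : tcoef (canD VA) (lact f t) = lact f (tcoef (canD VA) t).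
  move: t; apply: tlift_unique => [c x y|c x y|g v].
  - by rewrite lact_linear lD.
  - by rewrite lD lact_linear.
  - by rewrite /tcoef !(lact_tens, tmapE) //; exact: canD_linear.
by rewrite /total_deriv DE tderiv_lact (linear_funD (lact_linear f)) addrCA.
Qed.

Lemma total_deriv_linj v : total_deriv (linj v) = linj (canD VA v).
Proof.
rewrite /total_deriv /linj /tcoef /tderiv !tmapE //.
- by rewrite lderiv1 (linear_fun0 ((tens_bilinear _ _).1 _)) addr0.
- exact: lderiv_linear.
- exact: canD_linear.
Qed.

(** On f(z) (x) v the commutator of [lext A] with D + d/dz is f(z) times its
    value on 1 (x) v: the terms in f'(z) cancel. *)
Lemma total_deriv_commute A : linear A ->
  (forall v, tcoef (canD VA) (A v) - A (canD VA v) = - tderiv (A v)) <->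
  forall t, total_deriv (lext A t) = lext A (total_deriv t).
Proof.
move=> lA; have E v : tcoef (canD VA) (A v) - A (canD VA v) = - tderiv (A v) <->
    total_deriv (A v) = A (canD VA v).
  rewrite /total_deriv; split=> [h|<-]; last by rewrite opprD addNKr.
  by apply/eqP; rewrite -subr_eq0 addrAC h addNr.
split=> [h|h v]; last by apply/E; rewrite -(lext_linj _ lA) h total_deriv_linj lext_linj.
apply: tlift_unique => [c x y|c x y|f v].
- by rewrite lext_linear // total_deriv_linear.
- by rewrite total_deriv_linear lext_linear.
rewrite -lact_linj lext_lact // !total_deriv_lact (linear_funD (lext_linear lA)).
by rewrite !lext_lact // total_deriv_linj !lext_linj // (E v).1.
Qed.

End TotalDerivative.

(** * The linear extension of a pseudoderivation *)

Section Pseudoderivation.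
Variables (K : numFieldType) (V : lmodType K) (VA : vertexAlgebra V).
Variables (a : V -> ltensor V) (a_pder : pseudoderivation VA a).

Let la : linear a. Proof. by case: a_pder. Qed.

(** In the constant term in x of [a(z),Y(1,x)]1 = Y(a(z+x)1,x)1, the left-hand
    side vanishes since Y(1,x) is the identity, and the right-hand side is
    a(z)1 by creation. *)
Lemma pseudoderivation_vac : a (vac VA) = 0.
Proof.
case: a_pder => _ _ /(_ (vac VA) (vac VA) 0).
have Yvac w : Y VA (vac VA) w 0 = w by exact: (va_vacuum VA w (-1)).
have -> : Yz VA (vac VA) 0 (a (vac VA)) = a (vac VA).
  by move: (a _); apply: tlift_unique => [||f w];
    [exact: Yz_linear | exact: linear_idfun | rewrite Yz_tens Yvac].
by rewrite Yvac subrr Yzx_creation.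
Qed.

Lemma lext_Yz u n t :
  lext a (Yz VA u n t) = Yz VA u n (lext a t) + Yzx VA (tshift (a u)) n t.
Proof.
have [_ _ aY] := a_pder.
move: t; apply: tlift_unique => [c x y|c x y|f w].
- by rewrite Yz_linear lext_linear.
- by rewrite lext_linear // Yz_linear Yzx_linear scalerDr addrACA.
rewrite Yz_tens !lext_tens // Yz_lact -[tens f w]lact_linj Yzx_lact.
by rewrite -(linear_funD (lact_linear f)) -aY subrKC.
Qed.

(** On s = f(z) (x) u both sides expand by [Yzx_tshift_lact] with the same
    coefficients of f(z+x), through which [lext a] passes; what remains is
    [lext_Yz]. *)
Lemma lext_Yzx s n t : lext a (Yzx VA (tshift s) n t) =
  Yzx VA (tshift (lext a s)) n t + Yzx VA (tshift s) n (lext a t).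
Proof.
have le := lext_linear la.
move: s; apply: tlift_unique => [c x y|c x y|f u].
- by rewrite tshift_linear Yzx_linear_l le.
- by rewrite le !tshift_linear !Yzx_linear_l scalerDr addrACA.
rewrite -lact_linj lext_lact // lext_linj // !Yzx_tshift_lact.
have [N hN] := eventually_nat n (Yzx_bound VA (tshift (linj u)) t).
have [P hP] := eventually_nat n (Yzx_bound VA (tshift (linj u)) (lext a t)).
have [Q hQ] := eventually_nat n (Yzx_bound VA (tshift (a u)) t).
rewrite (linear_fsum_nat (n := N) le); last first.
  by move=> k /hN ->; exact: lact0.
rewrite -[X in X + _]scale1r -fsum_linear.
- apply: eq_fsbigr => k _; rewrite scale1r lext_lact // !Yzx_linj lext_Yz.
  by rewrite addrC (linear_funD (lact_linear _)).
- by apply: (finite_support_nat (N := Q)) => k /hQ ->; exact: lact0.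
- by apply: (finite_support_nat (N := P)) => k /hP ->; exact: lact0.
Qed.

Hypothesis a_nil : forall v, exists k, lpow a k v = 0.

Let le : linear (lext a). Proof. exact: lext_linear. Qed.
Let ne : locally_nilpotent (lext a). Proof. exact: lext_nilpotent. Qed.

Lemma expop_Yzx s n t : expop (lext a) (Yzx VA (tshift s) n t) =
  Yzx VA (tshift (expop (lext a) s)) n (expop (lext a) t).
Proof.
pose G i j := Yzx VA (tshift (divpow (lext a) i s)) n (divpow (lext a) j t).
have lY t' : linear (fun s' : ltensor V => Yzx VA (tshift s') n t').
  by move=> c x y; rewrite tshift_linear Yzx_linear_l.
have [N hN] := divpow_nilpotent ne s; have [P hP] := divpow_nilpotent ne t.
have G0 i j : (N + P <= i)%N || (N + P <= j)%N -> G i j = 0.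
  case/orP=> h; rewrite /G.
    by rewrite hN ?(linear_fun0 (lY _)) // (leq_trans (leq_addr P N)).
  by rewrite hP ?(linear_fun0 (Yzx_linear _ _ _)) // (leq_trans (leq_addl N P)).
have aG i j : lext a (G i j) = i.+1%:R *: G i.+1 j + j.+1%:R *: G i j.+1.
  rewrite lext_Yzx !divpowS //.
  congr (_ + _); first exact: (linear_funZ (lY _)).
  exact: (linear_funZ (Yzx_linear _ _ _)).
have -> : Yzx VA (tshift s) n t = G 0 0 by rewrite /G !divpow0.
rewrite (expop_leibniz le aG G0).
rewrite {2}/expop (linear_fsum_nat (lY _) hN).
apply: eq_fsbigr => i _.
by rewrite /expop (linear_fsum_nat (Yzx_linear _ _ _) hP).
Qed.

Lemma total_deriv_expop t :
  total_deriv VA (expop (lext a) t) = expop (lext a) (total_deriv VA t).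
Proof.
have [_ aD _] := a_pder.
have ca := (total_deriv_commute VA la).1 aD.
have ci k x : total_deriv VA (iter k (lext a) x) = iter k (lext a) (total_deriv VA x).
  by elim: k => // k IH; rewrite !iterS ca IH.
have [N hN] := divpow_nilpotent ne t.
rewrite {1}/expop (linear_fsum_nat (total_deriv_linear VA) hN); apply: eq_fsbigr => k _.
by rewrite /divpow (linear_funZ (total_deriv_linear VA)) ci.
Qed.

Lemma lexp_pseudoendomorphism : pseudoendomorphism VA (lexp a).
Proof.
have lA := lexp_linear la ne; split=> //.
- rewrite /lexp (fsum_nat (N := 1)).
    by rewrite big_ord1; exact: divpow0.
  case=> // k _; rewrite /lpow iterSr lext_linj // pseudoderivation_vac.
  by rewrite (linear_fun0 (iter_linear k le)) scaler0.
- apply/(total_deriv_commute VA lA) => t.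
  by rewrite !lext_lexp // total_deriv_expop.
- move=> v w n; rewrite -[lexp a v]/(expop (lext a) (linj v)).
  by rewrite -[lexp a w]/(expop (lext a) (linj w)) -expop_Yzx Yzx_linj Yz_tens.
Qed.

End Pseudoderivation.

(** * The inverse exponential *)

Section Inverse.
Variables (K : numFieldType) (V : lmodType K) (a : V -> ltensor V).
Hypotheses (la : linear a) (na : locally_nilpotent (lext a)).

Lemma opposite_nilpotent :
  linear (fun v => - a v) /\ locally_nilpotent (lext (fun v => - a v)).
Proof.
split=> [c x y|]; first by rewrite la opprD scalerN.
rewrite (funext (fun t => lextN t la)).
by apply: locally_nilpotentN => //; exact: lext_linear.
Qed.

(** Applying this to [- a] as well gives the inverse on the other side. *)
Lemma lexpN v : lext (lexp a) (lexp (fun w => - a w) v) = linj v.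
Proof.
rewrite lext_lexp // -[lexp (fun w => - a w) v]/(expop (lext _) (linj v)).
rewrite (funext (fun t => lextN t la)).
by rewrite expopN //; exact: lext_linear.
Qed.

End Inverse.

Theorem proposition2p12 (R : realType) (V : lmodType R[i])
    (VA : vertexAlgebra V) (a : V -> ltensor V)
    (a_pder : pseudoderivation VA a)
    (a_comm : self_commuting a)
    (a_nil : forall v : V, exists k : nat, (0 < k)%N /\ lpow a k v = 0) :
  pseudoautomorphism VA (lexp a).
Proof.
have a_nil' v : exists k, lpow a k v = 0.
  by have [k [_ ak]] := a_nil v; exists k.
have la : linear a by case: a_pder.
have na := lext_nilpotent la a_nil'.
have [lN nN] := opposite_nilpotent la na.
split; first exact: lexp_pseudoendomorphism.
exists (lexp (fun w => - a w)); split=> [|v|v]; first exact: lexp_linear.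
  exact: lexpN.
have aK : a = fun w => - (- a w) by apply/funext => w; rewrite opprK.
by rewrite {2}aK; exact: lexpN.
Qed.
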